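(* Let $A\neq0$, let $M_A\subset\mathbb{R}^6$ be the $5$-dimensional submanifold of triples of points $(x_i,y_i)$, $i=1,2,3$, in the plane spanning a triangle of signed area $A$, let $$Z_i=(x_{i+1}-x_{i+2})\,\partial_{x_i}+(y_{i+1}-y_{i+2})\,\partial_{y_i},\qquad i=1,2,3\ (\text{indices mod }3),$$ and let $\mathcal{D}=\{\sum_{i=1}^3u_iZ_i \mid \sum_{i=1}^3u_i=0\}$, a $(2,3,5)$ distribution on $M_A$. Then the Cartan quartic of $\mathcal{D}$ is equal to the form $$\sum_{i=1}^3u_iZ_i\ \longmapsto\ c\,(u_1^2+u_2^2+u_3^2)^2,\qquad \sum_{i=1}^3u_i=0,$$ where $c$ is a constant.
   Context: Setting: a point of $\mathbb{R}^6$ with coordinates $(x_1,y_1,x_2,y_2,x_3,y_3)$ encodes three points in the plane; the signed area is $A=\tfrac12\sum_{i=1}^3(y_ix_{i+1}-x_iy_{i+1})$. The $Z_i$ are tangent to every $M_A$. For a distribution put $\mathcal{D}^0=\mathcal D$, $\mathcal{D}^{I+1}=[\mathcal{D}^I,\mathcal{D}^I]+\mathcal{D}^I$; a rank $2$ distribution on a $5$-manifold is a $(2,3,5)$ distribution if $\mathcal{D},\mathcal{D}^1,\mathcal{D}^2$ have ranks $2,3,5$ at every point. Cartan quartic. Let $\mathcal{D}$ be a $(2,3,5)$ distribution on a $5$-manifold. Locally there exist coframes $(\theta^1,\dots,\theta^5)$ with $\mathcal{D}=\ker\theta^1\cap\ker\theta^2\cap\ker\theta^3$, and $1$-forms $\Omega_1,\dots,\Omega_7$,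 such that $$\begin{aligned} d\theta^1&=\theta^1\wedge(2\Omega_1+\Omega_4)+\theta^2\wedge\Omega_2+\theta^3\wedge\theta^4,\\ d\theta^2&=\theta^1\wedge\Omega_3+\theta^2\wedge(\Omega_1+2\Omega_4)+\theta^3\wedge\theta^5,\\ d\theta^3&=\theta^1\wedge\Omega_5+\theta^2\wedge\Omega_6+\theta^3\wedge(\Omega_1+\Omega_4)+\theta^4\wedge\theta^5,\\ d\theta^4&=\theta^1\wedge\Omega_7+\tfrac43\theta^3\wedge\Omega_6+\theta^4\wedge\Omega_1+\theta^5\wedge\Omega_2,\\ d\theta^5&=\theta^2\wedge\Omega_7-\tfrac43\theta^3\wedge\Omega_5+\theta^4\wedge\Omega_3+\theta^5\wedge\Omega_4 . \end{aligned}$$ The conformal class of the signature $(2,3)$ metric $g=2\theta^1\theta^5-2\theta^2\theta^4+\tfrac43(\theta^3)^2$ (with $\lambda\mu=\tfrac12(\lambda\otimes\mu+\mu\otimes\lambda)$) depends only on $\mathcal{D}$. Let $W$ be the Weyl tensor of $g$, with all indices lowered by $g$, and let $(e_1,\dots,e_5)$ be the frame dual to $(\theta^i)$, so $\mathcal{D}=\mathrm{Span}(e_4,e_5)$. The Cartan quartic is the homogeneous quartic form on $\mathcal{D}$ $$\mathcal{D}\ni s\,e_4+z\,e_5\ \longmapsto\ W(s e_4+z e_5,\ s e_1+z e_2,\ s e_1+z e_2,\ s e_4+z e_5),$$ which depends only on $\mathcal{D}$ (up to the choice of an overall universal normalization constant). *)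

(* Defs.v *)
From mathcomp Require Import all_boot all_order all_algebra.
From mathcomp Require Import all_classical all_reals all_analysis.

Set Implicit Arguments.
Unset Strict Implicit.
Unset Printing Implicit Defensive.

Import Order.TTheory GRing.Theory Num.Theory.
Import numFieldNormedType.Exports.

Local Open Scope classical_set_scope.
Local Open Scope ring_scope.

(** Calculus on a submanifold [M] of R^n.

    Every smooth function, vector field or 1-form on an embedded submanifold is
    locally the restriction of a smooth one defined on an open subset of R^n,
    and the exterior derivative and the Lie bracket commute with restriction.
    So objects on [M] near a point are given by ambient objects on an open
    neighbourhood [V] of it; conditions on them are imposed only at points of
    [M] in [V] and only on vectors tangent to [M]. *)

Fixpoint iter_derive (R : realType) (n : nat) (F : normedModType R)
    (vs : seq 'rV[R]_n) (f : 'rV[R]_n -> F) : 'rV[R]_n -> F :=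
  if vs is v :: vs' then iter_derive vs' ('D_v f) else f.

(** C^oo on the open set [V] *)
Definition smooth_on (R : realType) (n : nat) (F : normedModType R)
    (V : set 'rV[R]_n) (f : 'rV[R]_n -> F) : Prop :=
  forall vs q, V q -> differentiable (iter_derive vs f) q.

(** Velocities at [p] of the curves contained in [M] *)
Definition tangent (R : realType) (n : nat) (M : set 'rV[R]_n) (p : 'rV[R]_n) :
    set 'rV[R]_n :=
  [set v | exists gamma : R -> 'rV[R]_n,
    [/\ gamma 0 = p, \forall t \near (0 : R), M (gamma t)
      & is_derive (0 : R) (1 : R) gamma v]].

(** The covector [a] stands for [\sum_k a_k dx^k], and the matrix [B] for the
    bilinear form [\sum_(k, l) B_kl dx^k (x) dx^l]. *)
Definition ev1 (R : realType) (n : nat) (a v : 'rV[R]_n) : R :=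
  \sum_k a 0 k * v 0 k.

Definition ev2 (R : realType) (n : nat) (B : 'M[R]_n) (v w : 'rV[R]_n) : R :=
  (v *m B *m w^T) 0 0.

Definition wedge (R : realType) (n : nat) (a b : 'rV[R]_n) : 'M[R]_n :=
  a^T *m b - b^T *m a.

(** [('J alpha q) k l] is the derivative of [alpha_l] in the direction [x_k]. *)
Definition dform (R : realType) (n : nat) (alpha : 'rV[R]_n -> 'rV[R]_n)
    (q : 'rV[R]_n) : 'M[R]_n :=
  'J alpha q - ('J alpha q)^T.

Definition lie_bracket (R : realType) (n : nat) (X Y : 'rV[R]_n -> 'rV[R]_n)
    (q : 'rV[R]_n) : 'rV[R]_n :=
  'D_(X q) Y q - 'D_(Y q) X q.

(** [D] is a smooth distribution of rank [k] on [M]; the rows of [X] are a local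
    frame. *)
Definition is_distribution (R : realType) (n : nat) (M : set 'rV[R]_n) (k : nat)
    (D : 'rV[R]_n -> set 'rV[R]_n) : Prop :=
  forall p, M p -> exists (V : set 'rV[R]_n) (X : 'rV[R]_n -> 'M[R]_(k, n)),
    [/\ open V, V p, smooth_on V X &
      forall q, M q -> V q ->
        [/\ row_free (X q), D q = [set v | (v <= X q)%MS]
          & D q `<=` tangent M q]].

Definition is_section (R : realType) (n : nat) (M : set 'rV[R]_n)
    (D : 'rV[R]_n -> set 'rV[R]_n) (V : set 'rV[R]_n)
    (X : 'rV[R]_n -> 'rV[R]_n) : Prop :=
  smooth_on V X /\ forall q, M q -> V q -> D q (X q).

(** [[D, D] + D] *)
Definition derived (R : realType) (n : nat) (M : set 'rV[R]_n)
    (D : 'rV[R]_n -> set 'rV[R]_n) (p : 'rV[R]_n) : set 'rV[R]_n :=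
  [set v | exists (V : set 'rV[R]_n) (m : nat)
      (X Y : 'I_m -> 'rV[R]_n -> 'rV[R]_n) (Z : 'rV[R]_n -> 'rV[R]_n),
    [/\ open V /\ V p, forall i, is_section M D V (X i),
        forall i, is_section M D V (Y i), is_section M D V Z
      & v = \sum_i lie_bracket (X i) (Y i) p + Z p]].

Definition is_235 (R : realType) (n : nat) (M : set 'rV[R]_n)
    (D : 'rV[R]_n -> set 'rV[R]_n) : Prop :=
  [/\ is_distribution M 5 (tangent M), is_distribution M 2 D,
      is_distribution M 3 (derived M D)
    & is_distribution M 5 (derived M (derived M D))].

(** [e] is the frame of [M] dual to the coframe [theta]. *)
Definition is_coframe (R : realType) (n m : nat) (M V : set 'rV[R]_n)
    (theta e : 'I_m -> 'rV[R]_n -> 'rV[R]_n) : Prop :=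
  (forall i, smooth_on V (theta i)) /\
  forall q, M q -> V q ->
    [/\ forall j, tangent M q (e j q),
        forall i j, ev1 (theta i q) (e j q) = (i == j)%:R
      & forall v, tangent M q v -> v = \sum_i ev1 (theta i q) v *: e i q].

(** [omega] are the connection 1-forms, in the coframe [theta], of the
    Levi-Civita connection of the metric
    [\sum_(i, j) G_ij theta^i (x) theta^j], for a constant symmetric [G]:
    vanishing torsion (Cartan's first structure equation) and compatibility
    with the metric. *)
Definition is_levi_civita (R : realType) (n m : nat) (M V : set 'rV[R]_n)
    (G : 'M[R]_m) (theta : 'I_m -> 'rV[R]_n -> 'rV[R]_n)
    (omega : 'I_m -> 'I_m -> 'rV[R]_n -> 'rV[R]_n) : Prop :=
  (forall i j, smooth_on V (omega i j)) /\
  forall q, M q -> V q ->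
    (forall i v w, tangent M q v -> tangent M q w ->
       ev2 (dform (theta i) q) v w =
       - ev2 (\sum_j wedge (omega i j q) (theta j q)) v w) /\
    (forall i j v, tangent M q v ->
       ev1 (\sum_k (G i k *: omega k j q + G j k *: omega k i q)) v = 0).

(** Curvature 2-forms; [curvature_form omega q i j] evaluated on [(v, w)] is
    [theta^i (R(v, w) e_j)]. *)
Definition curvature_form (R : realType) (n m : nat)
    (omega : 'I_m -> 'I_m -> 'rV[R]_n -> 'rV[R]_n) (q : 'rV[R]_n)
    (i j : 'I_m) : 'M[R]_n :=
  dform (omega i j) q + \sum_k wedge (omega i k q) (omega k j q).

Section WeylTensor.
Context (R : realType) (n m : nat) (G : 'M[R]_m).
Context (theta e : 'I_m -> 'rV[R]_n -> 'rV[R]_n).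
Context (omega : 'I_m -> 'I_m -> 'rV[R]_n -> 'rV[R]_n).
Context (q : 'rV[R]_n).

(** [R_ijkl = g (e_i, R(e_k, e_l) e_j)] *)
Definition riemann (i j k l : 'I_m) : R :=
  \sum_h G i h * ev2 (curvature_form omega q h j) (e k q) (e l q).

Definition ricci (j l : 'I_m) : R :=
  \sum_i \sum_k invmx G i k * riemann i j k l.

Definition scalar_curvature : R :=
  \sum_j \sum_l invmx G j l * ricci j l.

Definition weyl_coef (i j k l : 'I_m) : R :=
  riemann i j k l
  - (m%:R - 2)^-1 * (G i k * ricci j l - G i l * ricci j k
                     + G j l * ricci i k - G j k * ricci i l)
  + ((m%:R - 1) * (m%:R - 2))^-1 * scalar_curvature
    * (G i k * G j l - G i l * G j k).

Definition weyl (a b c d : 'rV[R]_n) : R :=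
  \sum_i \sum_j \sum_k \sum_l
    weyl_coef i j k l * ev1 (theta i q) a * ev1 (theta j q) b
                      * ev1 (theta k q) c * ev1 (theta l q) d.

End WeylTensor.

Local Notation "a ∧ b" := (wedge a b) (at level 40) : ring_scope.

(** Right-hand sides of the structure equations of a (2,3,5) distribution, for
    covectors [t_i = theta^i] and [o_a = Omega_a], numbered from 1 *)
Definition cartan_rhs (R : realType) (n : nat) (t : 'I_5 -> 'rV[R]_n)
    (o : 'I_7 -> 'rV[R]_n) : seq 'M[R]_n :=
  let t1 := t (inord 0) in let t2 := t (inord 1) in let t3 := t (inord 2) in
  let t4 := t (inord 3) in let t5 := t (inord 4) in
  let o1 := o (inord 0) in let o2 := o (inord 1) in let o3 := o (inord 2) in
  let o4 := o (inord 3) in let o5 := o (inord 4) in let o6 := o (inord 5) in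
  let o7 := o (inord 6) in
  [:: t1 ∧ (2 *: o1 + o4) + t2 ∧ o2 + t3 ∧ t4;
      t1 ∧ o3 + t2 ∧ (o1 + 2 *: o4) + t3 ∧ t5;
      t1 ∧ o5 + t2 ∧ o6 + t3 ∧ (o1 + o4) + t4 ∧ t5;
      t1 ∧ o7 + (4 / 3) *: (t3 ∧ o6) + t4 ∧ o1 + t5 ∧ o2;
      t2 ∧ o7 - (4 / 3) *: (t3 ∧ o5) + t4 ∧ o3 + t5 ∧ o4].

(** [theta] is a coframe adapted to the distribution [D], with dual frame [e]. *)
Definition is_adapted_coframe (R : realType) (n : nat) (M : set 'rV[R]_n)
    (D : 'rV[R]_n -> set 'rV[R]_n) (V : set 'rV[R]_n)
    (theta e : 'I_5 -> 'rV[R]_n -> 'rV[R]_n)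
    (Omega : 'I_7 -> 'rV[R]_n -> 'rV[R]_n) : Prop :=
  [/\ is_coframe M V theta e,
      forall a, smooth_on V (Omega a),
      forall q, M q -> V q ->
        D q = [set v | [/\ tangent M q v, ev1 (theta (inord 0) q) v = 0,
                           ev1 (theta (inord 1) q) v = 0
                         & ev1 (theta (inord 2) q) v = 0]]
    & forall q v w, M q -> V q -> tangent M q v -> tangent M q w ->
        forall i : 'I_5, ev2 (dform (theta i) q) v w =
          ev2 (cartan_rhs (theta ^~ q) (Omega ^~ q))`_i v w].

(** Coefficients of
    [2 theta^1 theta^5 - 2 theta^2 theta^4 + 4/3 (theta^3)^2] *)
Definition cartan_metric (R : realType) : 'M[R]_5 :=
  delta_mx (inord 0) (inord 4) + delta_mx (inord 4) (inord 0)
  - delta_mx (inord 1) (inord 3) - delta_mx (inord 3) (inord 1)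
  + (4 / 3) *: delta_mx (inord 2) (inord 2).

(** [Q q], restricted to [D q], is the Cartan quartic of [D] at [q]. It does not
    depend on the adapted coframe, so one around each point determines it; the
    values of [Q q] outside [D q] are irrelevant. *)
Definition is_cartan_quartic (R : realType) (n : nat) (M : set 'rV[R]_n)
    (D : 'rV[R]_n -> set 'rV[R]_n) (Q : 'rV[R]_n -> 'rV[R]_n -> R) : Prop :=
  forall p, M p -> exists (V : set 'rV[R]_n)
      (theta e : 'I_5 -> 'rV[R]_n -> 'rV[R]_n)
      (Omega : 'I_7 -> 'rV[R]_n -> 'rV[R]_n)
      (omega : 'I_5 -> 'I_5 -> 'rV[R]_n -> 'rV[R]_n),
    [/\ open V /\ V p, is_adapted_coframe M D V theta e Omega,
        is_levi_civita M V (cartan_metric R) theta omega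
      & forall q, M q -> V q -> forall s z : R,
          let x := s *: e (inord 3) q + z *: e (inord 4) q in
          let y := s *: e (inord 0) q + z *: e (inord 1) q in
          Q q x = weyl (cartan_metric R) theta e omega q x y y x].

(** Coordinates [(x_1, y_1, x_2, y_2, x_3, y_3)] on R^6. The index [i : 'I_3]
    is cyclic: [i + 1] is taken modulo 3. *)
Definition ix (i : 'I_3) : 'I_6 := inord (2 * i).
Definition iy (i : 'I_3) : 'I_6 := inord (2 * i + 1).

Definition signed_area (R : realType) (p : 'rV[R]_6) : R :=
  2^-1 * \sum_(i < 3) (p 0 (iy i) * p 0 (ix (i + 1))
                       - p 0 (ix i) * p 0 (iy (i + 1))).

Definition triangles (R : realType) (A : R) : set 'rV[R]_6 :=
  [set p | signed_area p = A].

Definition Zfield (R : realType) (i : 'I_3) (p : 'rV[R]_6) : 'rV[R]_6 :=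
  (p 0 (ix (i + 1)) - p 0 (ix (i + 1 + 1))) *: delta_mx 0 (ix i)
  + (p 0 (iy (i + 1)) - p 0 (iy (i + 1 + 1))) *: delta_mx 0 (iy i).

Definition Zdistribution (R : realType) (p : 'rV[R]_6) : set 'rV[R]_6 :=
  [set v | exists u : 'I_3 -> R,
     \sum_i u i = 0 /\ v = \sum_i u i *: Zfield i p].

(* Main.v *)
Require Import Defs.
From mathcomp Require Import all_boot all_order all_algebra.
From mathcomp Require Import all_classical all_reals all_analysis.
From mathcomp Require Import ring lra.

Set Implicit Arguments.
Unset Strict Implicit.
Unset Printing Implicit Defensive.

Import Order.TTheory GRing.Theory Num.Theory.
Import numFieldNormedType.Exports.

Local Open Scope classical_set_scope.
Local Open Scope ring_scope.

(** The group of area-preserving affine maps of the plane acts simply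
    transitively on [M_A] and preserves the [Z_i], so everything is expressed in
    an invariant frame, whose structure constants are rational numbers: the
    vertices of a triangle form a 2 x 3 matrix [P], and the invariant vector
    fields are the [P |-> P B] with [B] a constant 3 x 3 matrix with zero column
    sums, tangent to [M_A] when [tr B = 0]. Starting from
    [e4 = Z1 - Z2] and [e5 = Z1 + Z2 - 2 Z3], Cartan's structure equations are
    solved by [e3 = [e5, e4]], [e1 = [e4, e3] + 11/5 e5] and
    [e2 = [e5, e3] - 33/5 e4]. The Weyl tensor enters the quartic through a
    totally null plane, where it equals the Riemann tensor, and the quartic of
    [s e4 + z e5] comes out as [189/25 (s^2 + 3 z^2)^2], while the [u_i] of this
    vector satisfy [\sum_i u_i^2 = 2 s^2 + 6 z^2]. *)

(** * Calculus of linear fields and forms *)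

Section Calculus.
Context (R : realType).

Lemma ev2E n (B : 'M[R]_n) v w :
  ev2 B v w = \sum_l (\sum_k v 0 k * B k l) * w 0 l.
Proof.
rewrite /ev2 mxE; apply: eq_bigr => l _; rewrite !mxE; congr (_ * _).
Qed.

Lemma is_derive_coord (V : normedModType R) m n (f : V -> 'M[R]_(m, n))
    t v (df : 'M[R]_(m, n)) i j :
  is_derive t v f df -> is_derive t v (fun s => f s i j) (df i j).
Proof.
move=> [fd <-]; have /derivable_mxP fij := fd.
apply: (DeriveDef (fij i j)); by rewrite derive_mx // mxE.
Qed.

Lemma is_derive_mx (V : normedModType R) m n (f : V -> 'M[R]_(m, n)) t v
    (df : 'M[R]_(m, n)) :
  (forall i j, is_derive t v (fun s => f s i j) (df i j)) ->
  is_derive t v f df.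
Proof.
move=> fij; have fd : derivable f t v by apply/derivable_mxP => i j; case: (fij i j).
apply: (DeriveDef fd); rewrite derive_mx //; apply/matrixP => i j.
by rewrite mxE; case: (fij i j).
Qed.

Lemma is_derive_ev2 (V : normedModType R) n (B : 'M[R]_n)
    (f g : V -> 'rV[R]_n) t v (df dg : 'rV[R]_n) :
  is_derive t v f df -> is_derive t v g dg ->
  is_derive t v (fun s => ev2 B (f s) (g s)) (ev2 B df (g t) + ev2 B (f t) dg).
Proof.
move=> fd gd.
have -> : (fun s => ev2 B (f s) (g s)) =
    \sum_l ((\sum_k (B k l *: (fun s => f s 0 k))) * (fun s => g s 0 l)).
  apply/funext => s; rewrite ev2E fct_sumE; apply: eq_bigr => l _.
  rewrite /GRing.mul /=; congr (_ * _); rewrite fct_sumE; apply: eq_bigr => k _.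
  exact: mulrC.
have fk k := is_derive_coord 0 k fd.
have gk k := is_derive_coord 0 k gd.
apply: is_derive_eq.
rewrite !ev2E -big_split /=; apply: eq_bigr => l _.
rewrite addrC fct_sumE; congr (_ + _).
  by congr (_ * _); apply: eq_bigr => k _; exact: mulrC.
rewrite [LHS](mulrC (g t 0 l)).
by congr (_ * _); apply: eq_bigr => k _; exact: mulrC.
Qed.

Lemma is_derive_comp_curve n (F : normedModType R) (Y : 'rV[R]_n -> F)
    (gamma : R -> 'rV[R]_n) (t : R) (v : 'rV[R]_n) :
  differentiable Y (gamma t) -> is_derive t (1 : R) gamma v ->
  is_derive t (1 : R) (Y \o gamma) ('D_v Y (gamma t)).
Proof.
move=> Yd [gd gv]; have /derivable1_diffP gdf := gd.
have cd : differentiable (Y \o gamma) t by exact: differentiable_comp.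
apply: DeriveDef; first exact/derivable1_diffP.
have gE : 'd gamma t 1 = v by rewrite -gv deriveE.
by rewrite deriveE // diff_comp //= gE -deriveE.
Qed.

Lemma derive_near_cst (F : normedModType R) (f : R -> F) (t : R) (c df : F) :
  is_derive t (1 : R) f df -> (\forall s \near t, f s = c) -> df = 0.
Proof.
move=> [fd <-] fc; rewrite (near_eq_derive (g := cst c)) ?derive_cst //.
Qed.

Lemma is_derive_mulmx (V : normedModType R) m n (B : 'M[R]_(m, n))
    (f : V -> 'rV[R]_m) t v (df : 'rV[R]_m) :
  is_derive t v f df -> is_derive t v (fun s => f s *m B) (df *m B).
Proof.
move=> fd; apply: is_derive_mx => i j.
have -> : (fun s => (f s *m B) i j) = \sum_k (B k j *: (fun s => f s i k)).
  apply/funext => s; rewrite mxE fct_sumE; apply: eq_bigr => k _; exact: mulrC.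
have fk k := is_derive_coord i k fd.
apply: is_derive_eq; rewrite mxE; apply: eq_bigr => k _; exact: mulrC.
Qed.

Definition affine_map n (F : normedModType R) (f : 'rV[R]_n -> F) :=
  exists (a : 'I_n -> F) (b : F), f = fun q => \sum_k q 0 k *: a k + b.

Lemma affine_differentiable n (F : normedModType R) (f : 'rV[R]_n -> F) q :
  affine_map f -> differentiable f q.
Proof.
move=> [a [b ->]].
have -> : (fun q : 'rV[R]_n => \sum_k q 0 k *: a k + b) =
    \sum_k (fun q : 'rV[R]_n => q 0 k *: a k) + cst b.
  by apply/funext => x; rewrite fctE fct_sumE.
apply: differentiableD; last exact: differentiable_cst.
by apply: differentiable_sum => k; apply: differentiableZl; exact: differentiable_coord.
Qed.

Lemma affine_derive n (F : normedModType R) (f : 'rV[R]_n -> F) v :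
  affine_map f -> affine_map ('D_v f).
Proof.
move=> [a [b ->]]; exists (fun=> 0), (\sum_k v 0 k *: a k).
apply/funext => q.
rewrite big1 ?add0r; last by move=> k _; rewrite scaler0.
have -> : (fun q : 'rV[R]_n => \sum_k q 0 k *: a k + b) =
    \sum_k (fun q : 'rV[R]_n => q 0 k *: a k) + cst b.
  by apply/funext => x; rewrite fctE fct_sumE.
have dk k : is_derive q v (fun q : 'rV[R]_n => q 0 k *: a k) (v 0 k *: a k).
  have cd : differentiable (fun q : 'rV[R]_n => q 0 k : R) q.
    exact: differentiable_coord.
  have zd := differentiableZl (a k) cd.
  apply: DeriveDef; first exact: diff_derivable.
  rewrite deriveE // diffZl // -deriveE //.
  have [_ ->] // := is_derive_coord 0 k (@is_derive_id R 'rV[R]_n q v).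
have [_ ->] := is_deriveD (is_derive_sum dk) (is_derive_cst b q v).
by rewrite addr0.
Qed.

Lemma affine_smooth n (F : normedModType R) V (f : 'rV[R]_n -> F) :
  affine_map f -> smooth_on V f.
Proof.
move=> fa vs q _; elim: vs f fa => [|v vs IH] f fa /=.
  exact: affine_differentiable.
by apply: IH; exact: affine_derive.
Qed.

Lemma mulmx_affine n m (B : 'M[R]_(n, m)) : affine_map (fun q : 'rV[R]_n => q *m B).
Proof.
exists (fun k => row k B), 0; apply/funext => q; rewrite addr0; exact: mulmx_sum_row.
Qed.

Lemma mulmx_smooth n m (B : 'M[R]_(n, m)) V : smooth_on V (fun q : 'rV[R]_n => q *m B).
Proof. exact/affine_smooth/mulmx_affine. Qed.

Lemma rowwise_smooth n m k (B : 'I_k -> 'M[R]_(n, m)) V :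
  smooth_on V (fun q : 'rV[R]_n => \matrix_(i < k) (q *m B i)).
Proof.
apply: affine_smooth; exists (fun j => \matrix_(i < k) row j (B i)), 0.
apply/funext => q; apply/matrixP => i l; rewrite addr0 !mxE summxE.
by apply: eq_bigr => j _; rewrite !mxE.
Qed.

Lemma derive_mulmx n m (B : 'M[R]_(n, m)) q v :
  'D_v (fun q : 'rV[R]_n => q *m B) q = v *m B.
Proof. by have [_ ->] := is_derive_mulmx B (@is_derive_id R 'rV[R]_n q v). Qed.

Lemma jacobian_mulmx n (B : 'M[R]_n) q : 'J (fun q : 'rV[R]_n => q *m B) q = B.
Proof.
apply/row_matrixP => i; rewrite !rowE -deriveEjacobian ?derive_mulmx //.
exact/affine_differentiable/mulmx_affine.
Qed.

Lemma dform_mulmx n (B : 'M[R]_n) q : dform (fun q : 'rV[R]_n => q *m B) q = B - B^T.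
Proof. by rewrite /dform jacobian_mulmx. Qed.

Lemma ev1_mulmx n (B : 'M[R]_n) q v : ev1 (q *m B) v = ev2 B q v.
Proof. by rewrite ev2E; apply: eq_bigr => l _; rewrite mxE. Qed.

Lemma ev2_tr n (B : 'M[R]_n) v w : ev2 B^T v w = ev2 B w v.
Proof.
have wBv : (w *m B *m v^T)^T = v *m B^T *m w^T by rewrite !trmx_mul trmxK mulmxA.
by rewrite /ev2 -wBv mxE.
Qed.

Lemma ev2B n (B C : 'M[R]_n) v w : ev2 (B - C) v w = ev2 B v w - ev2 C v w.
Proof. by rewrite /ev2 mulmxBr mulmxBl !mxE. Qed.

Section Tangent.
Context (n : nat) (M : set 'rV[R]_n) (V : set 'rV[R]_n) (p : 'rV[R]_n).
Context (oV : open V) (Vp : V p).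

Lemma ev2_tangent_derive (B : 'M[R]_n) (X : 'rV[R]_n -> 'rV[R]_n) c v :
  differentiable X p -> (forall q, M q -> V q -> ev2 B q (X q) = c) ->
  tangent M p v -> ev2 B p ('D_v X p) = - ev2 B v (X p).
Proof.
move=> Xd Xc [gamma [g0 gM gd]].
apply/eqP; rewrite -addr_eq0 addrC; apply/eqP.
have Xgd : differentiable X (gamma 0) by rewrite g0.
have := is_derive_ev2 B gd (is_derive_comp_curve Xgd gd).
rewrite /comp g0 => /derive_near_cst; apply; near=> t.
apply: Xc; near: t => //.
have gc : {for (0 : R), continuous gamma}.
  by apply: differentiable_continuous; apply/derivable1_diffP; case: gd.
apply: gc; rewrite g0; exact: open_nbhs_nbhs.
Unshelve. all: by end_near. Qed.

(* For the 1-form [alpha = q *m B], this is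
   [alpha [X, Y] = X (alpha Y) - Y (alpha X) - d alpha (X, Y)]. *)
Lemma ev2_lie_bracket (B : 'M[R]_n) (X Y : 'rV[R]_n -> 'rV[R]_n) :
  differentiable X p -> differentiable Y p ->
  (forall q, M q -> V q -> ev2 B q (X q) = 0) ->
  (forall q, M q -> V q -> ev2 B q (Y q) = 0) ->
  tangent M p (X p) -> tangent M p (Y p) ->
  ev2 B p (lie_bracket X Y p) = - ev2 (B - B^T) (X p) (Y p).
Proof.
move=> Xd Yd X0 Y0 tX tY.
have ev2Br v w : ev2 B p (v - w) = ev2 B p v - ev2 B p w.
  by rewrite /ev2 linearB /= mulmxBr !mxE.
rewrite ev2Br (ev2_tangent_derive Yd Y0 tX) (ev2_tangent_derive Xd X0 tY).
by rewrite ev2B ev2_tr opprB opprK addrC.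
Qed.

End Tangent.

End Calculus.

(** * The invariant frame *)

Lemma sum_inord (V : nmodType) n (F : 'I_n.+1 -> V) :
  \sum_(k < n.+1) F k = \sum_(k <- iota 0 n.+1) F (inord k).
Proof.
rewrite -[n.+1 in RHS]subn0 -/(index_iota 0 n.+1) big_mkord.
by apply: eq_bigr => k _; rewrite inord_val.
Qed.

Section Frame.
Context (R : realType).

(* Zero column sums: a 2 x 3 table stands for the 3 x 3 matrix whose last row is
   minus the sum of the other two. *)
Definition pad (s : seq (seq R)) (k l : nat) : R :=
  let x i := nth 0 (nth [::] s i) l in if k == 2 then - x 0 - x 1 else x k.

Definition field_mx (b : seq (seq R)) : 'M[R]_6 :=
  \matrix_(k, l) if odd k == odd l then pad b k./2 l./2 else 0.

(* [q *m form_mx t] is the 1-form [v |-> \sum_(k, l) t_kl det (P_k, v_l)]. *)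
Definition form_mx (t : seq (seq R)) : 'M[R]_6 :=
  \matrix_(k, l) if odd k == odd l then 0 else
                 if odd k then - pad t k./2 l./2 else pad t k./2 l./2.

Lemma signed_areaE (q : 'rV[R]_6) : signed_area q = 2^-1 *
  (q 0 (inord 1) * q 0 (inord 2) - q 0 (inord 0) * q 0 (inord 3)
   + (q 0 (inord 3) * q 0 (inord 4) - q 0 (inord 2) * q 0 (inord 5))
   + (q 0 (inord 5) * q 0 (inord 0) - q 0 (inord 4) * q 0 (inord 1))).
Proof.
rewrite /signed_area sum_inord /= !big_cons big_nil addr0 /ix /iy /=.
by rewrite !inordK //= addrA.
Qed.

Lemma ev2_form (t : seq (seq R)) v w : ev2 (form_mx t) v w =
  \sum_(k <- iota 0 3) \sum_(l <- iota 0 3) pad t k l *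
    (v 0 (inord k.*2) * w 0 (inord l.*2.+1)
     - v 0 (inord k.*2.+1) * w 0 (inord l.*2)).
Proof.
rewrite ev2E !sum_inord /= !big_cons !big_nil !sum_inord /= !big_cons !big_nil.
by rewrite !mxE !inordK //=; ring.
Qed.

Lemma mulmx_field (b : seq (seq R)) (q : 'rV[R]_6) l : (l < 6)%N ->
  (q *m field_mx b) 0 (inord l) =
  \sum_(k <- iota 0 3) q 0 (inord (odd l + k.*2)) * pad b k l./2.
Proof.
move=> hl; rewrite mxE sum_inord /= !big_cons !big_nil !mxE !inordK //=.
by case: (odd l) => /=; ring.
Qed.

Lemma ev2_form_field (t b : seq (seq R)) q :
  ev2 (form_mx t) q (q *m field_mx b) = - 2 * signed_area q *
    \sum_(l <- iota 0 3) (pad t 0 l * pad b 1 l - pad t 1 l * pad b 0 l).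
Proof.
rewrite ev2_form signed_areaE /= !big_cons !big_nil !mulmx_field //=.
by rewrite !big_cons !big_nil /pad /=; field.
Qed.

Lemma ev2_form_fields (t b c : seq (seq R)) q :
  ev2 (form_mx t) (q *m field_mx b) (q *m field_mx c) = - 2 * signed_area q *
    \sum_(k <- iota 0 3) \sum_(l <- iota 0 3)
      pad t k l * (pad b 0 k * pad c 1 l - pad b 1 k * pad c 0 l).
Proof.
rewrite ev2_form signed_areaE /= !big_cons !big_nil !mulmx_field //=.
by rewrite !big_cons !big_nil /pad /=; field.
Qed.

(* Indices start at 0, so the entries 0, ..., 4 are [e_1, ..., e_5]; the last one,
   the dilation about the centroid, is transverse to [triangles A], and the dual
   form is a multiple of the differential of the area. *)
Definition frame_tab : seq (seq (seq R)) :=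
  [:: [:: [:: -6; -(21/5); -(12/5)]; [:: 21/5; 6; 12/5]];
      [:: [:: -6; -(3/5); -6]; [:: -(3/5); -6; -6]];
      [:: [:: 0; 2; -2]; [:: -2; 0; 2]];
      [:: [:: 0; 1; 0]; [:: 1; 0; 0]];
      [:: [:: 0; -1; -2]; [:: 1; 0; 2]];
      [:: [:: 2/3; -(1/3); -(1/3)]; [:: -(1/3); 2/3; -(1/3)]]].

Definition coframe_tab : seq (seq (seq R)) :=
  [:: [:: [:: 0; 1/12; 0]; [:: 1/12; 0; 0]];
      [:: [:: 0; -(1/36); -(1/18)]; [:: 1/36; 0; 1/18]];
      [:: [:: -(1/6); 1/12; 1/12]; [:: 1/12; -(1/6); 1/12]];
      [:: [:: 1/2; 3/20; -(1/5)]; [:: -(3/20); -(1/2); 1/5]];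
      [:: [:: 1/6; -(11/60); 1/6]; [:: -(11/60); 1/6; 1/6]];
      [:: [:: 0; 1/2; -(1/2)]; [:: -(1/2); 0; 1/2]]].

Definition frame (a : nat) : 'M[R]_6 := field_mx (nth [::] frame_tab a).
Definition coframe (A : R) (a : nat) : 'M[R]_6 :=
  (-2 * A)^-1 *: form_mx (nth [::] coframe_tab a).

(* [d theta^i = \sum_(a < b) struct_half i a b theta^a /\ theta^b] *)
Definition struct_half (i a b : nat) : R :=
  match i, a, b with
  | 0, 0, 3 => -1 | 0, 1, 2 => 3/5 | 0, 1, 4 => 3 | 0, 2, 3 => 1
  | 1, 0, 2 => -(1/5) | 1, 0, 4 => 1 | 1, 1, 3 => 1 | 1, 2, 4 => 1
  | 2, 0, 1 => 243/25 | 2, 0, 3 => 9/5 | 2, 1, 4 => 27/5 | 2, 3, 4 => 1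
  | 3, 0, 2 => 567/25 | 3, 0, 4 => -(27/5) | 3, 1, 3 => -(27/5)
  | 3, 2, 4 => 33/5
  | 4, 0, 3 => -(9/5) | 4, 1, 2 => 567/25 | 4, 1, 4 => 27/5
  | 4, 2, 3 => -(11/5)
  | _, _, _ => 0
  end.
Definition struct_coef i a b : R := struct_half i a b - struct_half i b a.

Context (A : R) (hA : A != 0).

Lemma ev2Z n c (B : 'M[R]_n) v w : ev2 (c *: B) v w = c * ev2 B v w.
Proof. by rewrite /ev2 -scalemxAr -scalemxAl mxE. Qed.

Lemma coframe_frame q i j : triangles A q -> (i < 6)%N -> (j < 6)%N ->
  ev2 (coframe A i) q (q *m frame j) = (i == j)%:R.
Proof.
rewrite /triangles /= ev2Z ev2_form_field => ->; rewrite mulrA mulVf ?mul1r; last first.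
  by rewrite mulf_neq0 // oppr_eq0 pnatr_eq0.
rewrite /= !big_cons big_nil.
case: i => [|[|[|[|[|[|i]]]]]] //; case: j => [|[|[|[|[|[|j]]]]]] // _ _;
  by rewrite /pad /=; field.
Qed.

Lemma dcoframe_frame q i a b : triangles A q -> (i < 5)%N -> (a < 5)%N ->
  (b < 5)%N ->
  ev2 (coframe A i - (coframe A i)^T) (q *m frame a) (q *m frame b)
  = struct_coef i a b.
Proof.
rewrite /triangles /= => qA.
rewrite ev2B ev2_tr !ev2Z !ev2_form_fields qA -mulrBr -mulrBr mulrA.
rewrite mulVf ?mul1r; last by rewrite mulf_neq0 // oppr_eq0 pnatr_eq0.
rewrite /= !big_cons !big_nil.
case: i => [|[|[|[|[|i]]]]] //; case: a => [|[|[|[|[|a]]]]] //;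
  case: b => [|[|[|[|[|b]]]]] // _ _ _;
  by rewrite /pad /struct_coef /=; field.
Qed.

End Frame.

Section Triangles.
Context (R : realType) (A : R) (hA : A != 0).
Local Notation area_mx := (form_mx (nth [::] (coframe_tab R) 5)).

Lemma signed_area_ev2 q : signed_area q = - 2^-1 * ev2 area_mx q q.
Proof.
by rewrite signed_areaE ev2_form /= !big_cons !big_nil /pad /=; field.
Qed.

Lemma area_mxC v w : ev2 area_mx v w = ev2 area_mx w v.
Proof. by rewrite !ev2_form /= !big_cons !big_nil /pad /=; field. Qed.

Lemma signed_area_line q v (t : R) : signed_area (q + t *: v) =
  signed_area q - t * ev2 area_mx q v + t ^+ 2 * signed_area v.
Proof.
rewrite !signed_area_ev2 !ev2_form /= !big_cons !big_nil /pad /= !mxE.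
by field.
Qed.

Lemma signed_area_scale_x (q : 'rV[R]_6) (s : R) :
  signed_area (\row_k (if odd k then q 0 k else s * q 0 k)) = s * signed_area q.
Proof. by rewrite !signed_areaE !mxE !inordK //=; ring. Qed.

(* [q + t v] has signed area [A + t ^ 2 a]; rescaling its [x]-coordinates
   gives a curve in [triangles A] with the same velocity. *)
Lemma tangent_trianglesP q v : triangles A q ->
  tangent (triangles A) q v <-> ev2 area_mx q v = 0.
Proof.
move=> qA; split.
  move=> tv; have idd : differentiable (@idfun 'rV[R]_6) q by exact: ex_diff.
  have idc p : triangles A p -> [set: 'rV[R]_6] p -> ev2 area_mx p (idfun p) = -2 * A.
    move=> <- _; rewrite signed_area_ev2 /=; by field.
  have := ev2_tangent_derive openT I idd idc tv.
  rewrite (area_mxC v) derive_id /= => /eqP.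
  by rewrite -addr_eq0 -mulr2n mulrn_eq0 => /eqP.
move=> qv; set a := signed_area v.
pose g : R -> R := cst A + (@idfun R ^+ 2) * cst a.
have g0 : g 0 = A by rewrite /g !fctE /= expr0n mul0r addr0.
pose s : R -> R := fun t => A * (g t)^-1.
have gd : is_derive (0 : R) (1 : R) g 0.
  by apply: is_derive_eq; rewrite !fctE /= mulr0 scale0r !scaler0 !addr0.
have g0n : g 0 != 0 by rewrite g0.
have sd : is_derive (0 : R) (1 : R) s 0.
  have -> : s = A *: (fun t => (g t)^-1) by [].
  by apply: is_derive_eq; rewrite scaler0 scaler0.
have s0 : s 0 = 1 by rewrite /s g0 mulfV.
exists (fun t => \row_k
  (if odd k then (q + t *: v) 0 k else s t * (q + t *: v) 0 k)); split.
- by apply/rowP => k; rewrite mxE s0 mul1r if_same scale0r addr0.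
- have gn : \forall t \near (0 : R), g t != 0.
    have gc : {for (0 : R), continuous g}.
      by apply: differentiable_continuous; apply/derivable1_diffP; case: gd.
    exact: (cvgr_neq0 _ gc g0n).
  near=> t; rewrite /triangles /= signed_area_scale_x signed_area_line qv.
  have gt : g t != 0 by near: t.
  rewrite qA (_ : _ + _ = g t); first by rewrite mulfVK.
  by rewrite mulr0 subr0 /g !fctE.
- apply: is_derive_mx => i k.
  have ld : is_derive (0 : R) (1 : R) (fun t : R => (q + t *: v) 0 k) (v 0 k).
    have -> : (fun t : R => (q + t *: v) 0 k) = cst (q 0 k) + v 0 k *: @idfun R.
      by apply/funext => t; rewrite !mxE !fctE mulrC.
    by apply: is_derive_eq; rewrite add0r [_ *: _]mulr1.
  rewrite ord1.
  have [ok|ek] := boolP (odd k).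
    rewrite (_ : (fun _ => _) = (fun t : R => (q + t *: v) 0 k)) //.
    by apply/funext => t; rewrite mxE ok.
  have -> : (fun t => (\row_k
      (if odd k then (q + t *: v) 0 k else s t * (q + t *: v) 0 k)) 0 k) =
      s * (fun t : R => (q + t *: v) 0 k).
    by apply/funext => t; rewrite mxE (negbTE ek).
  apply: is_derive_eq; rewrite s0 scale1r scaler0 addr0 //.
Unshelve. all: by end_near. Qed.

End Triangles.

Lemma ev1_lincomb (R : realType) n k (a : 'rV[R]_n) (c : 'I_k -> R) v :
  ev1 a (\sum_i c i *: v i) = \sum_i c i * ev1 a (v i).
Proof.
rewrite /ev1; under eq_bigr do rewrite summxE mulr_sumr.
rewrite exchange_big; apply: eq_bigr => i _; rewrite mulr_sumr.
by apply: eq_bigr => l _; rewrite [X in _ * X]mxE mulrCA.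
Qed.

Section Flag.
Context (R : realType) (A : R) (hA : A != 0).
Local Notation M := (triangles A).
Local Notation cof := (coframe A).
Local Notation fr := (frame R).

Lemma frame_expand q v : M q ->
  v = \sum_(a < 6) ev2 (cof a) q v *: (q *m fr a).
Proof.
move=> Mq.
pose E := \matrix_(a < 6) (q *m fr a); pose T := \matrix_(a < 6) (q *m cof a).
have TE : T *m E^T = 1%:M.
  apply/matrixP => i j; rewrite [RHS]mxE -(coframe_frame hA Mq (ltn_ord i) (ltn_ord j)).
  rewrite -ev1_mulmx mxE; apply: eq_bigr => k _; by rewrite !mxE.
have /(congr1 trmx) := mulmx1C TE; rewrite trmx_mul trmxK trmx1 => ET.
rewrite -[LHS]mulmx1 -ET mulmxA mulmx_sum_row; apply: eq_bigr => a _.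
rewrite rowK; congr (_ *: _); rewrite -ev1_mulmx mxE; apply: eq_bigr => k _.
by rewrite !mxE mulrC.
Qed.

Lemma tangentP q v : M q -> tangent M q v <-> ev2 (cof 5) q v = 0.
Proof.
move=> Mq; rewrite tangent_trianglesP // /coframe ev2Z; split=> [->|/eqP].
  by rewrite mulr0.
by rewrite mulf_eq0 invr_eq0 mulf_eq0 oppr_eq0 pnatr_eq0 (negbTE hA) => /eqP.
Qed.

(* The span of the last [k] vectors of the frame [e_1, ..., e_5]. *)
Definition flag (k : nat) (q : 'rV[R]_6) : set 'rV[R]_6 :=
  [set v | forall a, (a < 5 - k)%N || (a == 5) -> ev2 (cof a) q v = 0].

Lemma flagP k q v : (k <= 5)%N -> M q ->
  flag k q v <->
  v = \sum_(i < k) ev2 (cof (5 - k + i)) q v *: (q *m fr (5 - k + i)).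
Proof.
move=> k5 Mq; split=> [vF|-> a ha].
  rewrite [LHS](frame_expand _ Mq) big_ord_recr /= vF ?eqxx ?orbT // scale0r addr0.
  rewrite -[in LHS](big_mkord xpredT (fun a => ev2 (cof a) q v *: (q *m fr a))).
  rewrite (big_cat_nat (leq0n (5 - k)) (leq_subr _ _)) /= big_nat.
  rewrite big1 ?add0r; last first.
    by move=> a /andP[_ ak]; rewrite vF ?ak // scale0r.
  rewrite -{1}[(5 - k)%N]add0n big_addn subKn // big_mkord.
  by apply: eq_bigr => i _; rewrite addnC.
have a6 : (a < 6)%N.
  by case/orP: ha => [/leq_trans -> //|/eqP -> //]; rewrite (leq_trans (leq_subr _ _)).
rewrite -ev1_mulmx ev1_lincomb big1 // => i _.
have i5 : (5 - k + i < 5)%N by rewrite -ltn_subRL subKn.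
have := coframe_frame hA Mq a6 (ltnW i5 : 5 - k + i < 6)%N.
rewrite (_ : (a == _)%:R = 0) => [ai|]; last first.
  case: (a =P _ + _)%N ha => // ->; rewrite ltnNge leq_addr /= => /eqP ik.
  by rewrite ik ltnn in i5.
by rewrite ev1_mulmx ai mulr0.
Qed.

Lemma frame_flag k q a : (a < 5)%N -> (5 - k <= a)%N -> M q -> flag k q (q *m fr a).
Proof.
move=> a5 ka Mq b hb.
have b6 : (b < 6)%N.
  by case/orP: hb => [/leq_trans -> //|/eqP -> //]; rewrite (leq_trans (leq_subr _ _)).
rewrite (coframe_frame hA Mq b6 (ltnW a5)); case: (b =P a) hb => // ->.
by rewrite ltnNge ka /= => /eqP a5'; rewrite a5' ltnn in a5.
Qed.

Lemma flag5 q : M q -> flag 5 q = tangent M q.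
Proof.
move=> Mq; apply/seteqP; split=> v /= => [vF|/(tangentP _ Mq) v5 a /eqP -> //].
by apply/(tangentP _ Mq)/vF.
Qed.

Lemma subset_flag k k' q : (k <= k')%N -> flag k q `<=` flag k' q.
Proof.
move=> kk' v vF a /orP[ak|a5]; apply: vF; rewrite ?a5 ?orbT //.
by rewrite (leq_trans ak) ?leq_sub2l.
Qed.

Lemma flag_tangent k q : (k <= 5)%N -> M q -> flag k q `<=` tangent M q.
Proof. by move=> k5 Mq; rewrite -flag5 //; exact: subset_flag. Qed.

Lemma flag_distribution k D : (k <= 5)%N -> (forall q, M q -> D q = flag k q) ->
  is_distribution M k D.
Proof.
move=> k5 DF p Mp; exists setT, (fun q => \matrix_(i < k) (q *m fr (5 - k + i))).
split; [exact: openT | by [] | exact: rowwise_smooth |].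
move=> q Mq _; split; last by rewrite DF //; exact: flag_tangent.
  apply/row_freeP; exists (\matrix_(i < k) (q *m cof (5 - k + i)))^T.
  apply/matrixP => i j; rewrite !mxE.
  have i5 (l : 'I_k) : (5 - k + l < 6)%N by rewrite ltnW // ltnS -ltn_subRL subKn.
  have := coframe_frame hA Mq (i5 j) (i5 i).
  rewrite eqn_add2l -ev1_mulmx eq_sym => <-.
  by apply: eq_bigr => l _; rewrite !mxE mulrC.
rewrite DF //; apply/seteqP; split=> v /=.
  move=> /(flagP _ k5 Mq) ->; apply: summx_sub => i _; apply: scalemx_sub.
  by rewrite -(rowK (fun i : 'I_k => q *m fr (5 - k + i)) i) row_sub.
move=> /submxP[c ->] a ha; rewrite mulmx_sum_row.
rewrite -ev1_mulmx ev1_lincomb big1 // => i _.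
have i5 : (5 - k + i < 5)%N by rewrite -ltn_subRL subKn.
rewrite rowK ev1_mulmx (@frame_flag k) ?mulr0 //.
exact: leq_addr.
Qed.

End Flag.

(** * The derived flag *)

Lemma ev1D (R : realType) n (a v w : 'rV[R]_n) : ev1 a (v + w) = ev1 a v + ev1 a w.
Proof. by rewrite /ev1 -big_split /=; apply: eq_bigr => l _; rewrite mxE mulrDr. Qed.

Lemma ev1Z (R : realType) n (a v : 'rV[R]_n) c : ev1 a (c *: v) = c * ev1 a v.
Proof. by rewrite /ev1 mulr_sumr; apply: eq_bigr => l _; rewrite mxE mulrCA. Qed.

Lemma ev2_lincomb (R : realType) n k l (B : 'M[R]_n) (c : 'I_k -> R) v
    (d : 'I_l -> R) w :
  ev2 B (\sum_i c i *: v i) (\sum_j d j *: w j) =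
  \sum_i \sum_j c i * d j * ev2 B (v i) (w j).
Proof.
rewrite -ev1_mulmx ev1_lincomb exchange_big; apply: eq_bigr => j _ /=.
rewrite ev1_mulmx -[B in LHS]trmxK ev2_tr -ev1_mulmx ev1_lincomb mulr_sumr.
by apply: eq_bigr => i _; rewrite ev1_mulmx ev2_tr mulrCA mulrA.
Qed.

Section Derived.
Context (R : realType) (A : R) (hA : A != 0).
Local Notation M := (triangles A).
Local Notation cof := (coframe A).
Local Notation fr := (frame R).

Lemma dcoframe_tangent q i v w : M q -> (i < 5)%N ->
  tangent M q v -> tangent M q w ->
  ev2 (cof i - (cof i)^T) v w =
  \sum_(a < 5) \sum_(b < 5)
    struct_coef R i a b * ev2 (cof a) q v * ev2 (cof b) q w.
Proof.
move=> Mq i5; rewrite -!(flag5 hA Mq) => /(flagP hA _ (leqnn 5) Mq) vE.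
move=> /(flagP hA _ (leqnn 5) Mq) wE; rewrite [in LHS]vE [in LHS]wE subnn ev2_lincomb.
apply: eq_bigr => a _; apply: eq_bigr => b _.
by rewrite !add0n (dcoframe_frame hA Mq i5 (ltn_ord a) (ltn_ord b)); ring.
Qed.

Lemma dcoframe5 v w : ev2 (cof 5 - (cof 5)^T) v w = 0.
Proof. by rewrite ev2B ev2_tr !ev2Z area_mxC subrr. Qed.

Lemma flagD k q v w : flag A k q v -> flag A k q w -> flag A k q (v + w).
Proof.
move=> vF wF a ha.
by rewrite -ev1_mulmx ev1D !ev1_mulmx vF // wF // addr0.
Qed.

Lemma flagZ k q c v : flag A k q v -> flag A k q (c *: v).
Proof.
move=> vF a ha.
by rewrite -ev1_mulmx ev1Z ev1_mulmx vF // mulr0.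
Qed.

Section OneStep.
Context (k : nat) (D : 'rV[R]_6 -> set 'rV[R]_6).
Context (k5 : (k <= 5)%N) (DF : forall q, M q -> D q = flag A k q).

Lemma derived_flag_sub k' p : (k <= k')%N -> M p ->
  (forall a v w, (a < 5 - k')%N -> flag A k p v -> flag A k p w ->
     ev2 (cof a - (cof a)^T) v w = 0) ->
  derived M D p `<=` flag A k' p.
Proof.
move=> kk' Mp dF v /= [V [m [X [Y [Z [[oV Vp] sX sY sZ ->]]]]]] a ha.
have hak : (a < 5 - k)%N || (a == 5).
  by case/orP: ha => [/leq_trans -> //|->]; rewrite ?orbT ?leq_sub2l.
have secF W : is_section M D V W ->
  [/\ differentiable W p, forall q, M q -> V q -> ev2 (cof a) q (W q) = 0,
      flag A k p (W p) & tangent M p (W p)].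
  move=> [sW DW]; have FW q : M q -> V q -> flag A k q (W q).
    by move=> Mq Vq; rewrite -DF //; exact: DW.
  split; [exact: (sW [::] p) | by move=> q Mq Vq; exact: FW | exact: FW |].
  by apply: (flag_tangent hA k5 Mp); exact: FW.
have [_ Z0 _ _] := secF _ sZ.
rewrite -ev1_mulmx (_ : \sum_i _ = \sum_i 1 *: lie_bracket (X i) (Y i) p); last first.
  by apply: eq_bigr => i _; rewrite scale1r.
rewrite -[Z p]scale1r.
rewrite ev1D ev1_lincomb scale1r [X in _ + X]ev1_mulmx Z0 // addr0 big1 // => i _.
have [Xd X0 XF Xt] := secF _ (sX i); have [Yd Y0 YF Yt] := secF _ (sY i).
rewrite ev1_mulmx (ev2_lie_bracket oV Vp Xd Yd X0 Y0 Xt Yt).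
by case/orP: ha => [ak|/eqP ->]; rewrite ?dcoframe5 ?dF // oppr0 mulr0.
Qed.

Lemma mulmx_section (S : 'M[R]_6) :
  (forall q, M q -> flag A k q (q *m S)) ->
  is_section M D setT (fun q => q *m S).
Proof.
move=> SF; split; first exact: mulmx_smooth.
by move=> q Mq _; rewrite DF //; exact: SF.
Qed.

End OneStep.

Lemma lie_bracket_mulmx n (S T : 'M[R]_n) q :
  lie_bracket (fun q => q *m S) (fun q => q *m T) q = q *m S *m T - q *m T *m S.
Proof. by rewrite /lie_bracket !derive_mulmx. Qed.

Lemma rowP_inord n (v w : 'rV[R]_n.+1) :
  (forall k, (k < n.+1)%N -> v 0 (inord k) = w 0 (inord k)) -> v = w.
Proof. by move=> vw; apply/rowP => k; rewrite -(inord_val k) vw. Qed.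

Lemma mx_addE m n (P Q : 'M[R]_(m, n)) i j : (P + Q) i j = P i j + Q i j.
Proof. exact: mxE. Qed.

Lemma mx_oppE m n (P : 'M[R]_(m, n)) i j : (- P) i j = - P i j.
Proof. exact: mxE. Qed.

Lemma mx_scaleE m n c (P : 'M[R]_(m, n)) i j : (c *: P) i j = c * P i j.
Proof. exact: mxE. Qed.

Lemma bracket_e5_e4 (q : 'rV[R]_6) : q *m fr 4 *m fr 3 - q *m fr 3 *m fr 4 = q *m fr 2.
Proof.
apply: rowP_inord => k k6; rewrite !(mx_addE, mx_oppE, mx_scaleE).
rewrite /frame; case: k k6 => [|[|[|[|[|[|k]]]]]] // _;
  rewrite !mulmx_field //= !big_cons !big_nil !mulmx_field //= !big_cons !big_nil;
  by rewrite /pad /=; field.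
Qed.

Lemma bracket_e4_e3 (q : 'rV[R]_6) : q *m fr 3 *m fr 2 - q *m fr 2 *m fr 3 =
  q *m fr 0 + (- (11 / 5)) *: (q *m fr 4).
Proof.
apply: rowP_inord => k k6; rewrite !(mx_addE, mx_oppE, mx_scaleE).
rewrite /frame; case: k k6 => [|[|[|[|[|[|k]]]]]] // _;
  rewrite !mulmx_field //= !big_cons !big_nil !mulmx_field //= !big_cons !big_nil;
  by rewrite /pad /=; field.
Qed.

Lemma bracket_e5_e3 (q : 'rV[R]_6) : q *m fr 4 *m fr 2 - q *m fr 2 *m fr 4 =
  q *m fr 1 + (33 / 5) *: (q *m fr 3).
Proof.
apply: rowP_inord => k k6; rewrite !(mx_addE, mx_oppE, mx_scaleE).
rewrite /frame; case: k k6 => [|[|[|[|[|[|k]]]]]] // _;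
  rewrite !mulmx_field //= !big_cons !big_nil !mulmx_field //= !big_cons !big_nil;
  by rewrite /pad /=; field.
Qed.

End Derived.

Section Main235.
Context (R : realType) (A : R) (hA : A != 0).
Local Notation M := (triangles A).
Local Notation cof := (coframe A).
Local Notation fr := (frame R).

Lemma Zfield_comb (u : 'I_3 -> R) q : \sum_i u i = 0 ->
  \sum_i u i *: Zfield i q =
  ((u (inord 0) - u (inord 1)) / 2) *: (q *m fr 3)
  + (- u (inord 2) / 2) *: (q *m fr 4).
Proof.
rewrite !sum_inord /= !big_cons !big_nil addr0 => u0.
have {u0} -> : u (inord 2) = - u (inord 0) - u (inord 1) by lra.
rewrite /Zfield /ix /iy /= !inordK //= !modnS /= .
apply: rowP_inord => k k6; rewrite !(mx_addE, mx_scaleE).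
rewrite /frame; case: k k6 => [|[|[|[|[|[|k]]]]]] // _;
  rewrite !mulmx_field //= !big_cons !big_nil !mxE -!val_eqE /= !inordK //=;
  by rewrite /pad /=; field.
Qed.

Lemma Zdistribution_flag q : M q -> Zdistribution q = flag A 2 q.
Proof.
move=> Mq; apply/seteqP.
split=> [v [u [u0 ->]]|v /(flagP hA _ (isT : (2 <= 5)%N) Mq) ->].
  by rewrite Zfield_comb //; apply: flagD; apply: flagZ; apply: frame_flag.
rewrite !sum_inord /= !big_cons !big_nil addr0 !inordK //=.
set s := ev2 _ _ _; set z := ev2 _ _ _.
exists (fun i => nth 0 [:: s + z; z - s; - (2 * z)] i).
have u0 : \sum_(i < 3) [:: s + z; z - s; - (2 * z)]`_i = 0.
  rewrite sum_inord /= !big_cons !big_nil !inordK //=; ring.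
split=> //; rewrite Zfield_comb // !inordK //=.
by congr (_ *: _ + _ *: _); field.
Qed.

Lemma struct_flag a q v w : M q -> (a < 2)%N -> flag A 2 q v -> flag A 2 q w ->
  ev2 (cof a - (cof a)^T) v w = 0.
Proof.
move=> Mq a2 vF wF; have a5 : (a < 5)%N by rewrite (leq_trans a2).
have vt := flag_tangent hA (isT : (2 <= 5)%N) Mq vF.
have wt := flag_tangent hA (isT : (2 <= 5)%N) Mq wF.
rewrite (dcoframe_tangent hA Mq a5 vt wt).
rewrite !sum_inord /= !big_cons !big_nil !sum_inord /= !big_cons !big_nil !inordK //=.
rewrite (vF 0) // (vF 1) // (vF 2) // (wF 0) // (wF 1) // (wF 2) //.
by case: a a2 a5 => [|[|a]] // _ _; rewrite /struct_coef /=; ring.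
Qed.

Lemma derived_Z q : M q -> derived M (@Zdistribution R) q = flag A 3 q.
Proof.
move=> Mq; apply/seteqP; split.
  apply: (derived_flag_sub hA _ Zdistribution_flag) => // a v w; exact: struct_flag.
move=> v /(flagP hA _ (isT : (3 <= 5)%N) Mq).
rewrite !sum_inord /= !big_cons !big_nil addr0 !inordK //=.
set x := ev2 _ _ _; set y := ev2 _ _ _; set z := ev2 _ _ _ => ->.
exists setT, 1, (fun _ q => q *m (x *: fr 4)), (fun _ q => q *m fr 3),
  (fun q => q *m (y *: fr 3 + z *: fr 4)); split.
- by split=> //; exact: openT.
- move=> _; apply: (mulmx_section Zdistribution_flag) => p Mp; rewrite -scalemxAr.
  by apply: flagZ; apply: frame_flag.
- by move=> _; apply: (mulmx_section Zdistribution_flag) => p Mp; apply: frame_flag.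
- apply: (mulmx_section Zdistribution_flag) => p Mp; rewrite mulmxDr -!scalemxAr.
  by apply: flagD; apply: flagZ; apply: frame_flag.
- rewrite big_ord1 lie_bracket_mulmx -scalemxAr -!scalemxAl -scalemxAr -scalerBr.
  by rewrite bracket_e5_e4 mulmxDr -!scalemxAr.
Qed.

Lemma derived2_Z q : M q ->
  derived M (derived M (@Zdistribution R)) q = tangent M q.
Proof.
move=> Mq; rewrite -flag5 //; apply/seteqP; split.
  exact: (derived_flag_sub hA _ derived_Z).
move=> v /(flagP hA _ (isT : (5 <= 5)%N) Mq).
rewrite !sum_inord /= !big_cons !big_nil addr0 !inordK //=.
set x0 := ev2 _ _ _; set x1 := ev2 _ _ _; set x2 := ev2 _ _ _.
set x3 := ev2 _ _ _; set x4 := ev2 _ _ _ => ->.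
exists setT, 2, (fun i q => q *m (nth 0 [:: x0; x1] i *: fr (3 + i))),
  (fun _ q => q *m fr 2),
  (fun q => q *m (x2 *: fr 2 + (x3 - 33 / 5 * x1) *: fr 3
                  + (x4 + 11 / 5 * x0) *: fr 4)); split.
- by split=> //; exact: openT.
- move=> i.
  apply: (mulmx_section (S := [:: x0; x1]`_i *: fr (3 + i)) derived_Z) => p Mp.
  rewrite -scalemxAr; apply: flagZ; apply: frame_flag => //.
  by case: i => [[|[|]]].
- by move=> _; apply: (mulmx_section derived_Z) => p Mp; apply: frame_flag.
- apply: (mulmx_section derived_Z) => p Mp; rewrite !mulmxDr -!scalemxAr.
  by do ?apply: flagD; apply: flagZ; apply: frame_flag.
- rewrite big_ord_recr big_ord1 !lie_bracket_mulmx /=.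
  rewrite -!scalemxAr -!scalemxAl -!scalerBr.
  rewrite bracket_e4_e3 bracket_e5_e3 !mulmxDr -!scalemxAr.
  by apply/rowP => k; rewrite !(mx_addE, mx_scaleE); field.
Qed.

Lemma Z_235 : is_235 M (@Zdistribution R).
Proof.
split; apply: (flag_distribution hA) => // q Mq.
- by rewrite flag5.
- exact: Zdistribution_flag.
- exact: derived_Z.
- by rewrite derived2_Z // flag5.
Qed.

End Main235.

(** * The Cartan quartic *)

Section Cartan.
Context (R : realType) (A : R) (hA : A != 0).
Local Notation M := (triangles A).
Local Notation cof := (coframe A).
Local Notation fr := (frame R).

(* [Omega_a = \sum_k Omega_coef a k theta^k] *)
Definition Omega_coef (a k : nat) : R :=
  match a, k with
  | 0, 1 => 27/5 | 0, 3 => -1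
  | 1, 0 => 27/5 | 1, 2 => 3/5 | 1, 4 => 3
  | 2, 0 => 9/5 | 2, 2 => -(1/5) | 2, 4 => 1
  | 3, 1 => -(27/5) | 3, 3 => 1
  | 4, 1 => 243/50 | 4, 3 => 9/5
  | 5, 0 => -(243/50) | 5, 4 => 27/5
  | 6, 2 => 81/5
  | _, _ => 0
  end.

(* [omega^i_j = \sum_k omega_coef i j k theta^k] *)
Definition omega_coef (i j k : nat) : R :=
  match i, j, k with
  | 0, 0, 1 => 27/5 | 0, 0, 3 => -1
  | 0, 1, 0 => 27/5 | 0, 1, 2 => 3/5 | 0, 1, 4 => 3
  | 0, 2, 3 => 2/3
  | 0, 3, 2 => -(1/3)
  | 1, 0, 0 => 9/5 | 1, 0, 2 => -(1/5) | 1, 0, 4 => 1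
  | 1, 1, 1 => -(27/5) | 1, 1, 3 => 1
  | 1, 2, 4 => 2/3
  | 1, 4, 2 => -(1/3)
  | 2, 0, 1 => 243/50 | 2, 0, 3 => 9/5
  | 2, 1, 0 => -(243/50) | 2, 1, 4 => 27/5
  | 2, 3, 4 => 1/2
  | 2, 4, 3 => -(1/2)
  | 3, 0, 2 => 81/5
  | 3, 2, 0 => -(162/25) | 3, 2, 4 => 36/5
  | 3, 3, 1 => 27/5 | 3, 3, 3 => -1
  | 3, 4, 0 => 27/5 | 3, 4, 2 => 3/5 | 3, 4, 4 => 3
  | 4, 1, 2 => 81/5
  | 4, 2, 1 => -(162/25) | 4, 2, 3 => -(12/5)
  | 4, 3, 0 => 9/5 | 4, 3, 2 => -(1/5) | 4, 3, 4 => 1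
  | 4, 4, 1 => -(27/5) | 4, 4, 3 => 1
  | _, _, _ => 0
  end.

Definition theta (i : 'I_5) (q : 'rV[R]_6) : 'rV[R]_6 := q *m cof i.
Definition dual_frame (i : 'I_5) (q : 'rV[R]_6) : 'rV[R]_6 := q *m fr i.
Definition Omega (a : 'I_7) (q : 'rV[R]_6) : 'rV[R]_6 :=
  q *m \sum_(k < 5) Omega_coef a k *: cof k.
Definition omega (i j : 'I_5) (q : 'rV[R]_6) : 'rV[R]_6 :=
  q *m \sum_(k < 5) omega_coef i j k *: cof k.

Lemma ev2_sum n k (B : 'I_k -> 'M[R]_n) v w :
  ev2 (\sum_i B i) v w = \sum_i ev2 (B i) v w.
Proof. by rewrite /ev2 mulmx_sumr mulmx_suml summxE. Qed.

Lemma ev2D n (B C : 'M[R]_n) v w : ev2 (B + C) v w = ev2 B v w + ev2 C v w.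
Proof. by rewrite /ev2 mulmxDr mulmxDl mxE. Qed.

Lemma ev2N n (B : 'M[R]_n) v w : ev2 (- B) v w = - ev2 B v w.
Proof. by rewrite /ev2 mulmxN mulNmx mxE. Qed.

Lemma ev2_wedge n (a b v w : 'rV[R]_n) :
  ev2 (wedge a b) v w = ev1 a v * ev1 b w - ev1 b v * ev1 a w.
Proof.
have ab (c d : 'rV[R]_n) : ev2 (c^T *m d) v w = ev1 c v * ev1 d w.
  rewrite /ev2 mulmxA -mulmxA mxE big_ord1 !mxE; congr (_ * _);
    by apply: eq_bigr => k _; rewrite !mxE // mulrC.
by rewrite /wedge ev2B !ab.
Qed.

Lemma ev1_addl n (a b v : 'rV[R]_n) : ev1 (a + b) v = ev1 a v + ev1 b v.
Proof. by rewrite /ev1 -big_split /=; apply: eq_bigr => k _; rewrite mxE mulrDl. Qed.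

Lemma ev1_scalel n c (a v : 'rV[R]_n) : ev1 (c *: a) v = c * ev1 a v.
Proof. by rewrite /ev1 mulr_sumr; apply: eq_bigr => k _; rewrite mxE mulrA. Qed.

Lemma ev1_suml n k (a : 'I_k -> 'rV[R]_n) v :
  ev1 (\sum_i a i) v = \sum_i ev1 (a i) v.
Proof.
rewrite /ev1 exchange_big; apply: eq_bigr => l _.
by rewrite summxE mulr_suml.
Qed.

Lemma Omega_theta a q v :
  ev1 (Omega a q) v = \sum_(k < 5) Omega_coef a k * ev1 (theta k q) v.
Proof.
rewrite /Omega /theta ev1_mulmx ev2_sum.
by apply: eq_bigr => k _; rewrite ev2Z ev1_mulmx.
Qed.

Lemma omega_theta i j q v :
  ev1 (omega i j q) v = \sum_(k < 5) omega_coef i j k * ev1 (theta k q) v.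
Proof.
rewrite /omega /theta ev1_mulmx ev2_sum.
by apply: eq_bigr => k _; rewrite ev2Z ev1_mulmx.
Qed.

Lemma theta_frame q i j : M q -> ev1 (theta i q) (dual_frame j q) = (i == j)%:R.
Proof.
move=> Mq; rewrite ev1_mulmx.
by rewrite (coframe_frame hA Mq (ltnW (ltn_ord i)) (ltnW (ltn_ord j))).
Qed.

Lemma frame_tangent q j : M q -> tangent M q (dual_frame j q).
Proof. by move=> Mq; rewrite -(flag5 hA Mq); apply: frame_flag. Qed.

Lemma theta_coframe : is_coframe M setT theta dual_frame.
Proof.
split=> [i|q Mq _]; first exact: mulmx_smooth.
split=> [j|i j|v]; [exact: frame_tangent | exact: theta_frame |].
rewrite -(flag5 hA Mq) => /(flagP hA _ (isT : (5 <= 5)%N) Mq) {1}->.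
by apply: eq_bigr => i _; rewrite ev1_mulmx subnn add0n.
Qed.

Lemma dtheta i q v w : M q -> tangent M q v -> tangent M q w ->
  ev2 (dform (theta i) q) v w = \sum_(a < 5) \sum_(b < 5)
    struct_coef R i a b * ev1 (theta a q) v * ev1 (theta b q) w.
Proof.
move=> Mq tv tw; rewrite /theta dform_mulmx (dcoframe_tangent hA Mq _ tv tw) //.
by apply: eq_bigr => a _; apply: eq_bigr => b _; rewrite !ev1_mulmx.
Qed.

Lemma sum5 (V : nmodType) (F : 'I_5 -> V) : \sum_(k < 5) F k =
  F (inord 0) + F (inord 1) + F (inord 2) + F (inord 3) + F (inord 4).
Proof. by rewrite sum_inord /= !big_cons big_nil addr0 !addrA. Qed.

Lemma struct_cartan_rhs n (t : 'I_5 -> 'rV[R]_n) (o : 'I_7 -> 'rV[R]_n)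
    (v w : 'rV[R]_n) (x y : nat -> R) (i : 'I_5) :
  (forall a, ev1 (t a) v = x a) -> (forall a, ev1 (t a) w = y a) ->
  (forall a, ev1 (o a) v = \sum_(k < 5) Omega_coef a k * x k) ->
  (forall a, ev1 (o a) w = \sum_(k < 5) Omega_coef a k * y k) ->
  \sum_(a < 5) \sum_(b < 5) struct_coef R i a b * x a * y b
  = ev2 (cartan_rhs t o)`_i v w.
Proof.
move=> tv tw ov ow; rewrite !sum5 !inordK //.
rewrite /cartan_rhs.
move: (ltn_ord i); case: (nat_of_ord i) => [|[|[|[|[|]]]]] // _;
  rewrite /= ?(ev2D, ev2N, ev2Z, ev2_wedge, ev1_addl, ev1_scalel);
  rewrite !(tv, tw, ov, ow) !sum5 !inordK // /struct_coef /=;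
  move: (x 0%N) (x 1%N) (x 2%N) (x 3%N) (x 4%N);
  move: (y 0%N) (y 1%N) (y 2%N) (y 3%N) (y 4%N) => *; by field.
Qed.

Lemma theta_structure q v w i : M q -> tangent M q v -> tangent M q w ->
  ev2 (dform (theta i) q) v w = ev2 (cartan_rhs (theta ^~ q) (Omega ^~ q))`_i v w.
Proof.
move=> Mq tv tw; rewrite dtheta //.
pose X u (k : nat) := ev1 (theta (inord k) q) u.
have XE u (a : 'I_5) : ev1 (theta a q) u = X u a by rewrite /X inord_val.
under eq_bigr do under eq_bigr do rewrite !XE.
by apply: struct_cartan_rhs => a; rewrite ?Omega_theta ?XE //;
  apply: eq_bigr => k _; rewrite XE.
Qed.

Lemma theta_adapted :
  is_adapted_coframe M (@Zdistribution R) setT theta dual_frame Omega.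
Proof.
split; [exact: theta_coframe | by move=> a; exact: mulmx_smooth | |].
  move=> q Mq _; rewrite (Zdistribution_flag hA Mq); apply/seteqP; split=> v /=.
    move=> vF; rewrite /theta !ev1_mulmx !inordK //.
    by split; [apply: (flag_tangent hA _ Mq vF) | exact: vF..].
  rewrite /theta !ev1_mulmx !inordK // => -[tv v0 v1 v2] a /orP[a3|/eqP ->].
    by case: a a3 => [|[|[|a]]].
  exact/(tangentP hA _ Mq).
by move=> q v w Mq _ tv tw i; exact: theta_structure.
Qed.

Lemma struct_omega n (t : 'I_5 -> 'rV[R]_n) (o : 'I_5 -> 'I_5 -> 'rV[R]_n)
    (v w : 'rV[R]_n) (x y : nat -> R) (i : 'I_5) :
  (forall a, ev1 (t a) v = x a) -> (forall a, ev1 (t a) w = y a) ->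
  (forall a b, ev1 (o a b) v = \sum_(k < 5) omega_coef a b k * x k) ->
  (forall a b, ev1 (o a b) w = \sum_(k < 5) omega_coef a b k * y k) ->
  \sum_(a < 5) \sum_(b < 5) struct_coef R i a b * x a * y b
  = - ev2 (\sum_j wedge (o i j) (t j)) v w.
Proof.
move=> tv tw ov ow; rewrite ev2_sum !sum5 !ev2_wedge.
rewrite !(tv, tw, ov, ow) !sum5 !inordK //.
move: (ltn_ord i); case: (nat_of_ord i) => [|[|[|[|[|]]]]] // _;
  rewrite /struct_coef /=;
  move: (x 0%N) (x 1%N) (x 2%N) (x 3%N) (x 4%N);
  move: (y 0%N) (y 1%N) (y 2%N) (y 3%N) (y 4%N) => *; by field.
Qed.

Definition metric_coef (a b : nat) : R :=
  match a, b with
  | 0, 4 | 4, 0 => 1 | 1, 3 | 3, 1 => -1 | 2, 2 => 4/3 | _, _ => 0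
  end.

Lemma cartan_metricE (i j : 'I_5) : cartan_metric R i j = metric_coef i j.
Proof.
rewrite /cartan_metric !mxE -!val_eqE /= !inordK //.
case: i j => [[|[|[|[|[|a]]]]] a5] [[|[|[|[|[|b]]]]] b5] //=;
  by rewrite ?mulr0 ?mulr1 ?subr0 ?addr0 ?add0r ?sub0r ?subr0.
Qed.

Lemma omega_levi_civita : is_levi_civita M setT (cartan_metric R) theta omega.
Proof.
split=> [i j|q Mq _]; first exact: mulmx_smooth.
pose X u (k : nat) := ev1 (theta (inord k) q) u.
have XE u (a : 'I_5) : ev1 (theta a q) u = X u a by rewrite /X inord_val.
have OE u a b : ev1 (omega a b q) u = \sum_(k < 5) omega_coef a b k * X u k.
  by rewrite omega_theta; apply: eq_bigr => k _; rewrite XE.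
split=> [i v w tv tw|i j v tv].
  rewrite dtheta //; under eq_bigr do under eq_bigr do rewrite !XE.
  exact: (struct_omega i (XE v) (XE w) (OE v) (OE w)).
rewrite ev1_suml; under eq_bigr do rewrite ev1_addl !ev1_scalel !OE.
rewrite !sum5 !cartan_metricE !inordK //.
move: (X v) (ltn_ord i) (ltn_ord j) => x.
move: (nat_of_ord i) (nat_of_ord j) => a b a5 b5.
move: (x 0%N) (x 1%N) (x 2%N) (x 3%N) (x 4%N) => x0 x1 x2 x3 x4 {OE XE X}.
case: a a5 => [|[|[|[|[|a]]]]] //; case: b b5 => [|[|[|[|[|b]]]]] // _ _ /=;
  by field.
Qed.
End Cartan.

Section Quartic.
Context (R : realType) (A : R) (hA : A != 0).
Local Notation M := (triangles A).
Local Notation cof := (coframe A).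
Local Notation fr := (frame R).
Local Notation theta := (theta A).
Local Notation omega := (omega A).
Local Notation dual_frame := (@dual_frame R).

(* [theta^h (R(e_k, e_l) e_j)] *)
Definition curvature_coef (h j k l : nat) : R :=
  \sum_(m < 5) omega_coef R h j m * struct_coef R m k l +
  \sum_(r < 5) (omega_coef R h r k * omega_coef R r j l
                - omega_coef R r j k * omega_coef R h r l).

Definition curvature_tab (h j k l : nat) : R :=
  match h, j, k, l with
  | 1, 0, 0, 3 => -(189/25) | 1, 0, 1, 4 => -(108/25)
  | 1, 1, 0, 4 => -(189/25) | 1, 1, 1, 3 => -(54/5)
  | 0, 0, 0, 4 => 54/5   | 0, 0, 1, 3 => 189/25
  | 0, 1, 0, 3 => 108/25 | 0, 1, 1, 4 => 1701/25
  | _, _, _, _ => 0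
  end.

Lemma curvature_coefE h j k l : (h < 2)%N -> (j < 2)%N -> (k < 2)%N -> (l < 2)%N ->
  curvature_coef h j k (3 + l) = curvature_tab h j k (3 + l).
Proof.
move=> h2 j2 k2 l2; rewrite /curvature_coef !sum5 !inordK //.
case: h h2 => [|[|h //]] _; case: j j2 => [|[|j //]] _;
  case: k k2 => [|[|k //]] _; case: l l2 => [|[|l //]] _;
  by rewrite /struct_coef /=; field.
Qed.

Lemma omega_frame q (i j k : 'I_5) : M q ->
  ev1 (omega i j q) (dual_frame k q) = omega_coef R i j k.
Proof.
move=> Mq; rewrite omega_theta (bigD1 k) //= theta_frame // eqxx mulr1 big1 ?addr0 //.
by move=> l lk; rewrite theta_frame // (negbTE lk) mulr0.
Qed.

Lemma curvature_frame q (h j k l : 'I_5) : M q ->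
  ev2 (curvature_form omega q h j) (dual_frame k q) (dual_frame l q) =
  curvature_coef h j k l.
Proof.
move=> Mq; rewrite /curvature_form ev2D ev2_sum; congr (_ + _); last first.
  by apply: eq_bigr => r _; rewrite ev2_wedge !omega_frame.
rewrite /omega dform_mulmx ev2B ev2_tr !ev2_sum -sumrB; apply: eq_bigr => m _.
rewrite !ev2Z -mulrBr -(dcoframe_frame hA Mq (ltn_ord m) (ltn_ord k) (ltn_ord l)).
by rewrite [in RHS]ev2B ev2_tr !ev2Z.
Qed.

Lemma riemann_frame q (i j k l : 'I_5) : M q ->
  riemann (cartan_metric R) dual_frame omega q i j k l =
  \sum_(h < 5) metric_coef R i h * curvature_coef h j k l.
Proof.
move=> Mq; apply: eq_bigr => h _.
by rewrite curvature_frame // cartan_metricE.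
Qed.

Lemma weyl_nested (x y : 'rV[R]_6) q :
  weyl (cartan_metric R) theta dual_frame omega q x y y x =
  \sum_i ev1 (theta i q) x * \sum_j ev1 (theta j q) y *
    \sum_k ev1 (theta k q) y * \sum_l ev1 (theta l q) x *
      weyl_coef (cartan_metric R) dual_frame omega q i j k l.
Proof.
rewrite /weyl; apply: eq_bigr => i _; rewrite mulr_sumr; apply: eq_bigr => j _.
rewrite !mulr_sumr; apply: eq_bigr => k _; rewrite !mulr_sumr; apply: eq_bigr => l _.
by rewrite -!mulrA; move: (weyl_coef _ _ _ _ _ _ _ _) => W; ring.
Qed.

Lemma theta_comb q (a b : 'I_5) (s z : R) (F : 'I_5 -> R) : M q -> a != b ->
  \sum_i ev1 (theta i q) (s *: dual_frame a q + z *: dual_frame b q) * F i =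
  s * F a + z * F b.
Proof.
move=> Mq ab; under eq_bigr do rewrite ev1D !ev1Z !theta_frame //.
rewrite (bigD1 a) // (bigD1 b) /=; last by rewrite eq_sym.
rewrite !eqxx (negbTE ab) eq_sym (negbTE ab) big1 => [|i /andP[ia ib]]; last first.
  by rewrite (negbTE ia) (negbTE ib) !mulr0 addr0 mul0r.
by rewrite !mulr1 !mulr0 addr0 add0r addr0.
Qed.

(* [x] and [y] span a totally null plane, so that the Ricci and scalar
   curvature terms of the Weyl tensor do not contribute. *)
Lemma weyl_quartic q (a b c d : 'I_5) (s z : R) : M q ->
  a = 3 :> nat -> b = 4 :> nat -> c = 0 :> nat -> d = 1 :> nat ->
  let x := s *: dual_frame a q + z *: dual_frame b q in
  let y := s *: dual_frame c q + z *: dual_frame d q in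
  weyl (cartan_metric R) theta dual_frame omega q x y y x =
  189 / 25 * (s ^+ 2 + 3 * z ^+ 2) ^+ 2.
Proof.
move=> Mq a3 b4 c0 d1 x y.
have ab : a != b by rewrite -val_eqE /= a3 b4.
have cd : c != d by rewrite -val_eqE /= c0 d1.
have xE F : \sum_i ev1 (theta i q) x * F i = s * F a + z * F b by exact: theta_comb.
have yE F : \sum_i ev1 (theta i q) y * F i = s * F c + z * F d by exact: theta_comb.
move: x y xE yE => x y xE yE; rewrite weyl_nested xE !yE !xE.
rewrite /weyl_coef; move: (ricci _ _ _ _) (scalar_curvature _ _ _ _) => ric sc.
move: (5 - 2)^-1 ((5 - 1) * (5 - 2))^-1 => u v.
rewrite !riemann_frame //.
rewrite !sum5 !inordK //.
rewrite !cartan_metricE.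
rewrite ?a3 ?b4 ?c0 ?d1 /= !(mul0r, add0r, addr0).
rewrite ?(@curvature_coefE _ _ _ 0) ?(@curvature_coefE _ _ _ 1) //=.
by field.
Qed.

Lemma Zfield_frame (u : 'I_3 -> R) q : M q -> \sum_i u i = 0 ->
  6 * ev2 (cof 4) q (\sum_i u i *: Zfield i q) ^+ 2
  + 2 * ev2 (cof 3) q (\sum_i u i *: Zfield i q) ^+ 2 = \sum_i u i ^+ 2.
Proof.
move=> Mq u0; rewrite Zfield_comb // -!ev1_mulmx !ev1D !ev1Z !ev1_mulmx.
rewrite !(coframe_frame hA Mq) //=.
move: u0; rewrite !sum_inord /= !big_cons !big_nil !addr0 => u0.
have -> : u (inord 2) = - u (inord 0) - u (inord 1) by lra.
by field.
Qed.

Definition Zquartic (q v : 'rV[R]_6) : R :=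
  189 / 100 * (6 * ev2 (cof 4) q v ^+ 2 + 2 * ev2 (cof 3) q v ^+ 2) ^+ 2.

Lemma Z_cartan_quartic : is_cartan_quartic M (@Zdistribution R) Zquartic.
Proof.
move=> p Mp; exists setT, theta, dual_frame, (Omega A), omega; split.
- by split=> //; exact: openT.
- exact: theta_adapted.
- exact: omega_levi_civita.
- move=> q Mq _ s z x y; rewrite weyl_quartic // ?inordK //.
  rewrite /Zquartic /x /dual_frame !inordK // -!ev1_mulmx !ev1D !ev1Z !ev1_mulmx.
  by rewrite !(coframe_frame hA Mq) //=; field.
Qed.

End Quartic.

Theorem proposition5p2 (R : realType) (A : R) (hA : A != 0) :
  is_235 (triangles A) (@Zdistribution R) /\
  exists (c : R) (Q : 'rV[R]_6 -> 'rV[R]_6 -> R),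
    is_cartan_quartic (triangles A) (@Zdistribution R) Q /\
    forall (p : 'rV[R]_6) (u : 'I_3 -> R),
      triangles A p -> \sum_i u i = 0 ->
      Q p (\sum_i u i *: Zfield i p) = c * (\sum_i u i ^+ 2) ^+ 2.
Proof.
split; first exact: Z_235.
exists (189 / 100), (Zquartic A); split; first exact: Z_cartan_quartic.
by move=> p u Mp u0; rewrite /Zquartic Zfield_frame.
Qed.
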